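(* Let $\mathcal{U}$ be a finite set of objects equipped with a symmetric relation called ''being $t$-intersecting'', and use the terminology below. Let $N_0$ be the size of the extremal $t$-intersecting families, let $N_1$ be the largest size of a maximal $t$-intersecting family that is not extremal (with $N_1=0$ if there is no such family), let $N_2$ be such that any two distinct extremal $t$-intersecting families have at most $N_2$ members in common, and let $M$ be such that there are at most $M$ maximal $t$-intersecting families. Suppose \[ N_0 - \max(N_1,N_2) - \frac{6\log_2 M}{2\log_2 3 - 3} > 0. \] Then every family $\mathcal{F}\subseteq\mathcal{U}$ has at most $3^{N_0}$ $(3,t)$-colourings, with equality if and only if $\mathcal{F}$ is an extremal $t$-intersecting family.
   Context: In the intended applications, $\mathcal{U}$ is the set of $k$-subsets of $[n]$ (two sets are $t$-intersecting if they share at least $t$ elements), the set of $k$-dimensional subspaces of $\mathbb{F}_q^n$ (two subspaces are $t$-intersecting if their intersection has dimension at least $t$), or the symmetric group $S_n$ (two permutations are $t$-intersecting if they agree on at least $t$ indices). A family $\mathcal{F}\subseteq\mathcal{U}$ is $t$-intersecting if every two distinct members of $\mathcal{F}$ are $t$-intersecting. A $t$-intersecting family is maximal if it is not properly contained in another $t$-intersecting family $\mathcal{G}\subseteq\mathcal{U}$. A $t$-intersecting family is extremal if it has the maximum possible size among all $t$-intersecting families in $\mathcal{U}$. For an integer $r\ge1$, an $(r,t)$-colouring of a family $\mathcal{F}$ is a map $\mathcal{F}\to\{1,\dots,r\}$ such that every colour class is a $t$-intersecting family. *)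

(* Defs.v *)
From mathcomp Require Import all_boot all_order all_algebra.
From mathcomp Require Import reals exp.

Set Implicit Arguments.
Unset Strict Implicit.
Unset Printing Implicit Defensive.

Import Order.TTheory GRing.Theory Num.Theory.

Section Families.

(* [e x y] reads "x and y are t-intersecting"; the parameter t is part of [e]. *)
Variables (U : finType) (e : rel U).
Implicit Types F G : {set U}.

Definition intersecting F : bool :=
  [forall x in F, forall y in F, (x != y) ==> e x y].

Definition maximal_intersecting F : bool :=
  intersecting F && [forall G, intersecting G ==> ~~ (F \proper G)].

Definition extremal_intersecting F : bool :=
  intersecting F && [forall G, intersecting G ==> (#|G| <= #|F|)].

(* Colours {1, ..., r} are represented by 'I_r. *)
Definition colour_class (r : nat) F (c : {ffun {x : U | x \in F} -> 'I_r})
  (i : 'I_r) : {set U} := [set val x | x in [set x | c x == i]].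

Definition colourings (r : nat) F : {set {ffun {x : U | x \in F} -> 'I_r}} :=
  [set c | [forall i, intersecting (colour_class c i)]].

End Families.

Definition log2 (R : realType) (x : R) : R := (ln x / ln 2)%R.

(* Main.v *)
(* Every colour class extends to a maximal intersecting family, so each colouring
   of F is compatible with one of at most M^3 triples of maximal families; the
   number of colourings compatible with a triple is the product over x in F of
   the number k_x of members of the triple containing x.  If F lies in no
   extremal family, at most max(N1, N2) elements x have k_x = 3, while the k_x
   sum to at most 3 N0.  Since k^2 <= 2^k for k < 3 and 9 = (9/8) 2^3, the
   squared product is at most 8^D 9^(N0 - D) with D = N0 - max(N1, N2), and the
   gap hypothesis says exactly that M^6 8^D < 9^D.  If F lies in an extremal
   family, all 3^|F| maps are colourings. *)
Require Import Defs.
From mathcomp Require Import all_boot all_order all_algebra.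
From mathcomp Require Import reals exp.
From mathcomp Require Import ring lra.

Set Implicit Arguments.
Unset Strict Implicit.
Unset Printing Implicit Defensive.

Import Order.TTheory GRing.Theory Num.Theory.

Section IntersectingFamilies.

Variables (U : finType) (e : rel U).
Implicit Types F G : {set U}.

Lemma intersecting0 : intersecting e set0.
Proof. by apply/forall_inP => x; rewrite inE. Qed.

Lemma intersectingS F G : F \subset G -> intersecting e G -> intersecting e F.
Proof.
move=> /subsetP sFG /forall_inP iG; apply/forall_inP => x /sFG /iG /forall_inP iGx.
by apply/forall_inP => y /sFG /iGx.
Qed.

Lemma extremal_exists : exists E, extremal_intersecting e E.
Proof.
case: (arg_maxnP (fun F => #|F|) intersecting0) => E iE maxE.
by exists E; rewrite /extremal_intersecting iE; apply/forall_inP.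
Qed.

Lemma extremal_maximal E :
  extremal_intersecting e E -> maximal_intersecting e E.
Proof.
move=> /andP[iE /forall_inP maxE]; rewrite /maximal_intersecting iE.
apply/forall_inP => G /maxE leGE; apply/negP => /proper_card.
by rewrite ltnNge leGE.
Qed.

Lemma extends_to_maximal F : intersecting e F ->
  exists2 G, maximal_intersecting e G & F \subset G.
Proof.
move=> /maxset_exists[G /maxsetP[iG maxG] sFG]; exists G => //.
rewrite /maximal_intersecting iG; apply/forall_inP => H iH.
apply/negP => /properP[sGH [x xH]]; apply/negP.
by rewrite negbK -(maxG H iH sGH).
Qed.

(** The condition on [c] is pointwise, so the colours are chosen independently at each [x] and the
    count factors as a product. *)
Definition compatible (r : nat) F (t : {ffun 'I_r -> {set U}}) :
    {set {ffun {x : U | x \in F} -> 'I_r}} :=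
  [set c : {ffun {x : U | x \in F} -> 'I_r} | [forall x, val x \in t (c x)]].

Lemma card_compatible (r : nat) F (t : {ffun 'I_r -> {set U}}) :
  #|compatible F t| =
  \prod_(x : {x : U | x \in F}) #|[set i | val x \in t i]|.
Proof.
pose P (x : {x : U | x \in F}) : pred 'I_r := [pred i | val x \in t i].
have -> : #|compatible F t| = #|family P|.
  apply: eq_card => c; rewrite inE.
  by apply/forallP/familyP => H x; have := H x; rewrite !inE.
rewrite card_family foldrE big_map big_enum.
by apply: eq_bigr => x _; apply: eq_card => i; rewrite !inE.
Qed.

(** Union bound over the [r]-tuples of maximal families: enlarging each colour class to a maximal
    family makes the colouring compatible with such a tuple. *)
Lemma card_colourings_le (r B : nat) F :
  (forall t : {ffun 'I_r -> {set U}},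
     (forall i, maximal_intersecting e (t i)) -> #|compatible F t| <= B) ->
  #|colourings e r F| <= #|[set G | maximal_intersecting e G]| ^ r * B.
Proof.
move=> leB; set MM := [set G | _].
pose T : {set {ffun 'I_r -> {set U}}} := [set t in ffun_on MM].
have sub : colourings e r F \subset \bigcup_(t in T) compatible F t.
  apply/subsetP => c; rewrite inE => /forallP ic.
  have [t maxt subt] := fin_all_exists2 (fun i => extends_to_maximal (ic i)).
  apply/bigcupP; exists (finfun t).
    by rewrite inE; apply/ffun_onP => i; rewrite ffunE inE.
  rewrite inE; apply/forallP => x; rewrite ffunE.
  by apply: (subsetP (subt (c x))); apply: imset_f; rewrite inE.
have -> : #|MM| ^ r = #|T|.
  by rewrite -[r in LHS]card_ord -card_ffun_on; apply: eq_card => t; rewrite in_set.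
apply: leq_trans (subset_leq_card sub) _; rewrite -sum_nat_const.
apply: (@leq_trans (\sum_(t in T) #|compatible F t|)).
  apply: (big_ind2 (fun (A : {set _}) n => #|A| <= n)) => [|A m A' m' leA leA'|//].
    by rewrite cards0.
  by apply: leq_trans (leq_card_setU A A') (leq_add leA leA').
apply: leq_sum => t; rewrite inE => /ffun_onP MMt; apply: leB => i.
by have := MMt i; rewrite inE.
Qed.

Lemma colourings_intersecting (r : nat) F :
  intersecting e F -> #|colourings e r F| = r ^ #|F|.
Proof.
move=> iF; rewrite (_ : colourings e r F = setT).
  by rewrite cardsT card_ffun card_ord card_sig.
apply/setP => c; rewrite !inE; apply/forallP => i.
apply: intersectingS iF; apply/subsetP => _ /imsetP[x _ ->].
exact: valP.
Qed.

Lemma card_val_preim F (P : pred U) :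
  #|[set x : {x : U | x \in F} | P (val x)]| <= #|[set x | P x]|.
Proof.
rewrite -(card_imset _ val_inj); apply: subset_leq_card.
by apply/subsetP => _ /imsetP[x Px ->]; move: Px; rewrite !inE.
Qed.

(** Double counting of the pairs [(x, i)] with [val x \in t i]. *)
Lemma sum_multiplicity_le (r n : nat) F (t : {ffun 'I_r -> {set U}}) :
  (forall i, #|t i| <= n) ->
  \sum_(x : {x : U | x \in F}) #|[set i | val x \in t i]| <= r * n.
Proof.
move=> len; under eq_bigr => x _ do rewrite -sum1dep_card big_mkcond.
rewrite exchange_big /= -[X in X * n]card_ord -sum_nat_const.
apply: leq_sum => i _; rewrite -big_mkcond sum1dep_card.
apply: leq_trans (card_val_preim _ (mem (t i))) (leq_trans _ (len i)).
by apply: subset_leq_card; apply/subsetP => x; rewrite inE.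
Qed.

(* [9 = (9/8) * 2 ^ 3], with the fraction cleared. *)
Lemma sqr_le_exp2 k : k <= 3 -> k ^ 2 * 8 ^ (k == 3) <= 2 ^ k * 9 ^ (k == 3).
Proof. by case: k => [|[|[|[|k]]]]. Qed.

(** Let [s <= n'] count the [x] lying in all three families. Multiplying [sqr_le_exp2] over [x]
    bounds the square by [8 ^ n * (9/8) ^ s], which grows with [s]. *)
Lemma card_compatible_sqr (n n' : nat) F (t : {ffun 'I_3 -> {set U}}) :
  n' <= n -> (forall i, #|t i| <= n) -> #|\bigcap_i t i| <= n' ->
  #|compatible F t| ^ 2 <= 8 ^ (n - n') * 9 ^ n'.
Proof.
move=> len'n len len'; rewrite card_compatible.
set k := fun x : {x : U | x \in F} => #|[set i | val x \in t i]|.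
have lek x : k x <= 3 by rewrite -[3]card_ord max_card.
set s := \sum_x (k x == 3 : nat).
have les : s <= n'.
  apply: leq_trans len'; rewrite /s /nat_of_bool -big_mkcond sum1dep_card.
  rewrite -[#|\bigcap_i t i|]cardsE.
  apply: leq_trans (card_val_preim F (mem (\bigcap_i t i))).
  apply: subset_leq_card; apply/subsetP => x; rewrite !inE => /eqP kx.
  apply/bigcapP => i _; have : [set i | val x \in t i] == setT.
    by rewrite eqEcard subsetT cardsT card_ord -/(k x) kx.
  by move=> /eqP/setP/(_ i); rewrite !inE.
have leks : (\prod_x k x) ^ 2 * 8 ^ s <= 2 ^ (\sum_x k x) * 9 ^ s.
  rewrite !expn_sum -mulnn -!big_split /=.
  by apply: leq_prod => x _; rewrite mulnn; apply: sqr_le_exp2.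
(* The factor [8 ^ s] clears the denominator, keeping the argument in [nat]. *)
rewrite -(leq_pmul2r (expn_gt0 8 s)).
apply: leq_trans leks _.
apply: (@leq_trans (8 ^ n * 9 ^ s)).
  rewrite leq_mul2r (_ : 8 = 2 ^ 3) // -expnM leq_exp2l //.
  by rewrite (sum_multiplicity_le F len) orbT.
(* Cancelling [8 ^ (n - n')], then [8 ^ s * 9 ^ s], leaves [8 ^ (n' - s) <= 9 ^ (n' - s)]. *)
rewrite -{1}(subnK len'n) expnD -!mulnA leq_mul2l; apply/orP; right.
rewrite -(subnK les) !expnD -!mulnA [9 ^ s * 8 ^ s]mulnC.
rewrite leq_mul2r; apply/orP; right.
by case: (n' - s) => [//|m]; rewrite leq_exp2r.
Qed.

End IntersectingFamilies.

(** Since [2 log2 3 - 3 = log2 (9/8)], the gap reads [6 ln M < (n - n') (ln 9 - ln 8)]. As [M >= 1],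
    the subtracted quotient is nonnegative, which forces [n' < n]. *)
Lemma gap_expn (R : realType) (n n' M : nat) : 0 < M ->
  (n%:R - n'%:R
    - 6%:R * log2 (M%:R : R) / (2%:R * log2 (3%:R : R) - 3%:R) > 0)%R ->
  n' < n /\ M ^ 6 * 8 ^ (n - n') < 9 ^ (n - n').
Proof.
move=> M_gt0; have M0 : (0 < M%:R :> R)%R by rewrite ltr0n.
have l2 : (0 < ln 2 :> R)%R by rewrite ln_gt0 // ltr1n.
have lM : (0 <= ln (M%:R) :> R)%R by rewrite ln_ge0 // ler1n.
have E8 : (ln 8 = ln 2 *+ 3 :> R)%R.
  by rewrite -lnXn ?ltr0n // -natrX.
have E9 : (ln 9 = ln 3 *+ 2 :> R)%R.
  by rewrite -lnXn ?ltr0n // -natrX.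
have l89 : (ln 8 < ln 9 :> R)%R by rewrite ltr_ln ?posrE ?ltr0n // ltr_nat.
rewrite /log2 (_ : (6 * _ / _)%R = (6 * ln M%:R / (ln 9 - ln 8))%R :> R); last first.
  rewrite E8 E9; field.
  by rewrite !mulr_natr -E8 -E9 subr_eq0 gt_eqF // gt_eqF.
rewrite subr_gt0 => gap.
have lt_n : n' < n.
  rewrite -(ltr_nat R) -subr_gt0; apply: le_lt_trans gap.
  by rewrite divr_ge0 ?mulr_ge0 ?subr_ge0 // ltW.
split=> //; rewrite -(ltr_nat R) natrM !natrX.
rewrite -ltr_ln ?posrE ?mulr_gt0 ?exprn_gt0 ?ltr0n //.
rewrite lnM ?posrE ?exprn_gt0 ?ltr0n // !lnXn ?ltr0n //.
move: gap; rewrite ltr_pdivrMr ?subr_gt0 // -natrB 1?ltnW //.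
rewrite -!(mulr_natr (ln _)); lra.
Qed.

Theorem theorem1p2 (R : realType) (U : finType) (e : rel U)
    (e_sym : symmetric e) (N0 N1 N2 M : nat)
    (hN0 : forall F : {set U}, extremal_intersecting e F -> #|F| = N0)
    (hN1 : N1 = \max_(F : {set U} | maximal_intersecting e F
                                    && ~~ extremal_intersecting e F) #|F|)
    (hN2 : forall F G : {set U}, extremal_intersecting e F ->
       extremal_intersecting e G -> F != G -> #|F :&: G| <= N2)
    (hM : #|[set F : {set U} | maximal_intersecting e F]| <= M)
    (hgap : (N0%:R - (maxn N1 N2)%:R
             - 6%:R * log2 (M%:R : R) / (2%:R * log2 (3%:R : R) - 3%:R) > 0)%R) :
  forall F : {set U},
    #|colourings e 3 F| <= 3 ^ N0
    /\ (#|colourings e 3 F| = 3 ^ N0 <-> extremal_intersecting e F).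
Proof.
move=> F; have [E extE] := extremal_exists e.
have M_gt0 : 0 < M.
  apply: leq_trans hM; apply/card_gt0P; exists E.
  by rewrite inE extremal_maximal.
have le_N0 G : intersecting e G -> #|G| <= N0.
  by case/andP: (extE) => _ /forall_inP maxE /maxE; rewrite (hN0 E extE).
have [lt_gap ltM] := gap_expn M_gt0 hgap.
set N' := maxn N1 N2 in lt_gap ltM.
(* Inside an extremal family the count is exactly [3 ^ #|F|], so equality amounts to [#|F| = N0]. *)
case: (boolP [exists E', extremal_intersecting e E' && (F \subset E')]).
  move=> /existsP[E' /andP[/andP[iE' _] sFE']].
  have iF := intersectingS sFE' iE'.
  rewrite colourings_intersecting // leq_exp2l // le_N0 //; split=> //.
  split=> [/eqP|/hN0 -> //]; rewrite eqn_exp2l // => /eqP cardF.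
  by rewrite /extremal_intersecting iF; apply/forall_inP => G /le_N0; rewrite cardF.
move=> /existsPn notE.
suff lt3 : #|colourings e 3 F| < 3 ^ N0.
  split; first exact: ltnW.
  split=> [eq3|extF]; first by rewrite eq3 ltnn in lt3.
  by have := notE F; rewrite extF subxx.
have compat_sqr (t : {ffun 'I_3 -> {set U}}) :
    (forall i, maximal_intersecting e (t i)) ->
    #|compatible F t| ^ 2 <= 8 ^ (N0 - N') * 9 ^ N'.
  move=> maxt; have it i : intersecting e (t i) by case/andP: (maxt i).
  (* A compatible map witnesses that the triple covers [F]. *)
  have [->//|/card_gt0P[c]] := posnP #|compatible F t|.
  rewrite inE => /forallP ct.
  apply: card_compatible_sqr => [|i|]; [exact: ltnW|exact: le_N0|].
  (* A non-extremal member bounds the intersection by [N1], and two distinct extremal members by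
     [N2]. Three equal extremal members would contain [F], which is excluded. *)
  have [/forallP extt|/forallPn[i next]] :=
      boolP [forall i, extremal_intersecting e (t i)]; last first.
    apply: leq_trans (leq_maxl _ _); rewrite hN1.
    apply: leq_trans (subset_leq_card (bigcap_inf i _)) _ => //.
    by apply: leq_bigmax_cond; rewrite maxt.
  have [/forallP eqt|/forallPn[i neq]] := boolP [forall i, t i == t ord0].
    have := notE (t ord0); rewrite extt /= => /negP[]; apply/subsetP => x xF.
    by rewrite -(eqP (eqt (c (Sub x xF)))); apply: ct (Sub x xF).
  apply: leq_trans (leq_maxr _ _); apply: leq_trans (hN2 _ _ (extt i) (extt ord0) neq).
  by apply: subset_leq_card; rewrite subsetI !bigcap_inf.
pose B := \max_(t : {ffun 'I_3 -> {set U}} | [forall i, maximal_intersecting e (t i)])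
            #|compatible F t|.
have leC : #|colourings e 3 F| <= M ^ 3 * B.
  apply: (leq_trans (card_colourings_le (B := B) _)).
    by move=> t /forallP maxt; apply: leq_bigmax_cond.
  by rewrite leq_mul2r leq_exp2r ?hM ?orbT.
have leB : B ^ 2 <= 8 ^ (N0 - N') * 9 ^ N'.
  rewrite /B; apply: (big_ind (fun b => b ^ 2 <= 8 ^ (N0 - N') * 9 ^ N')) => //.
    by move=> x y; case: (leqP x y).
  by move=> t /forallP; apply: compat_sqr.
(* Only [B ^ 2] is controlled, so both sides are squared. With [D = N0 - N'], the chain is [M ^ 6 *
   B ^ 2 <= M ^ 6 * 8 ^ D * 9 ^ N' < 9 ^ D * 9 ^ N' = 9 ^ N0]. *)
rewrite -(ltn_exp2r _ _ (isT : 0 < 2)) -expnM mulnC expnM.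
apply: (@leq_ltn_trans ((M ^ 3 * B) ^ 2)); first by rewrite leq_exp2r.
rewrite expnMn -expnM -[X in _ < _ ^ X](subnK (ltnW lt_gap)) expnD.
apply: (@leq_ltn_trans (M ^ 6 * 8 ^ (N0 - N') * 9 ^ N')).
  by rewrite -mulnA leq_mul2l leB orbT.
by rewrite ltn_pmul2r ?expn_gt0.
Qed.
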